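(* Let $\mu$ be a nonnegative Radon measure on $[0,T]$, let $h:[0,T]\times\mathbb R^d\to\overline{\mathbb R}$ be a convex normal integrand, and let $S_t=\mathrm{cl}\,\mathrm{dom}\,h_t$. Assume that $$S_t=\mathrm{cl}\{y_t\mid y\in D(S)\}\quad\forall t\in[0,T],\qquad D(S)=\mathrm{cl}(\mathrm{dom}\,I_h\cap D(S)),$$ where the latter closure is with respect to the supremum norm. Then $$\inf_{y\in D(S)}I_h(y)=\int\inf_{y\in\mathbb R^d}h_t(y)\,d\mu_t$$ as soon as the left side is less than $+\infty$.
   Context: $T\in(0,+\infty]$. $D$ is the space of $\mathbb R^d$-valued càdlàg functions on $[0,T]$ with the supremum norm (left limits at $T$ exist also when $T=\infty$). A convex normal integrand is a function $h:[0,T]\times\mathbb R^d\to\overline{\mathbb R}$ whose epigraphical mapping $t\mapsto\{(x,a)\in\mathbb R^d\times\mathbb R\mid h_t(x)\le a\}$ is closed convex-valued and measurable (preimages $\{t\mid \mathrm{epi}\,h_t\cap O\neq\emptyset\}$ of open sets $O$ are measurable). $\mathrm{dom}\,h_t=\{y\in\mathbb R^d\mid h_t(y)<\infty\}$, $I_h(y)=\int_{[0,T]}h_t(y_t)\,d\mu_t$, $\mathrm{dom}\,I_h=\{I_h<\infty\}$, and $D(S)=\{y\in D\mid y_t\in S_t\ \forall t\}$. An integral is defined as $+\infty$ unless the positive part is integrable. *)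

(* Defs.v *)
From HB Require Import structures.
From mathcomp Require Export all_boot all_order all_algebra.
From mathcomp Require Export all_classical all_reals all_analysis.
(* [all_analysis] does not export the Borel structure of [\bar R]. *)
From mathcomp Require Export measurable_realfun.
Export numFieldNormedType.Exports.
Export Order.TTheory GRing.Theory Num.Theory.

Set Implicit Arguments.
Unset Strict Implicit.
Unset Printing Implicit Defensive.

Local Open Scope classical_set_scope.
Local Open Scope ring_scope.

(* Functions on [0, T] are total functions on [\bar R] and measures on [0, T]
   are Borel measures on [\bar R]; only their restrictions to [time T] matter.
   For T = +oo this is the compact interval [0, +oo], endpoint included. *)
Definition time (R : realType) (T : \bar R) : set (\bar R) :=
  [set t | (0 <= t <= T)%E].

Definition radon_measure (R : realType) (T : \bar R)
    (mu : {measure set (\bar R) -> \bar R}) : Prop :=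
  (forall K : set (\bar R), compact K -> K `<=` time T -> (mu K < +oo)%E) /\
  (forall A : set (\bar R), measurable A -> A `<=` time T ->
     mu A = ereal_sup [set mu K | K in [set K | compact K /\ K `<=` A]]).

(* MathComp-Analysis' own convention for +oo - (+oo) is -oo. *)
Definition conv_integral (R : realType) (T : \bar R)
    (mu : {measure set (\bar R) -> \bar R}) (f : \bar R -> \bar R) : \bar R :=
  if `[< mu.-integrable (time T) (f^\+)%E >]
  then (\int[mu]_(t in time T) f t)%E else +oo%E.

(* The norm on ['rV[R]_d] is the maximum norm; every notion below depends on
   it only through its equivalence class. *)
Definition cadlag (R : realType) (d : nat) (T : \bar R)
    (y : \bar R -> 'rV[R]_d) : Prop :=
  (forall t, (0 <= t < T)%E ->
     y s @[s --> within [set s | (t < s <= T)%E] (nbhs t)] --> y t) /\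
  (forall t, (0 < t <= T)%E ->
     exists l : 'rV[R]_d,
       y s @[s --> within [set s | (0 <= s < t)%E] (nbhs t)] --> l).

Definition sup_norm (R : realType) (d : nat) (T : \bar R)
    (y : \bar R -> 'rV[R]_d) : \bar R :=
  ereal_sup [set `|y t|%:E | t in time T].

Definition cadlag_closure (R : realType) (d : nat) (T : \bar R)
    (A : set (\bar R -> 'rV[R]_d)) : set (\bar R -> 'rV[R]_d) :=
  [set y | cadlag T y /\
     forall e : R, 0 < e ->
       exists2 z, A z & (sup_norm T (fun t => (y t - z t)%R) < e%:E)%E].

Definition cadlag_selections (R : realType) (d : nat) (T : \bar R)
    (S : \bar R -> set 'rV[R]_d) : set (\bar R -> 'rV[R]_d) :=
  [set y | cadlag T y /\ forall t, time T t -> S t (y t)].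

Definition epi (R : realType) (d : nat) (g : 'rV[R]_d -> \bar R) :
    set ('rV[R]_d * R)%type :=
  [set xa | (g xa.1 <= xa.2%:E)%E].

Definition edom (R : realType) (d : nat) (g : 'rV[R]_d -> \bar R) :
    set 'rV[R]_d :=
  [set x | (g x < +oo)%E].

Definition convex_normal_integrand (R : realType) (d : nat) (T : \bar R)
    (h : \bar R -> 'rV[R]_d -> \bar R) : Prop :=
  (forall t, time T t ->
     closed (epi (h t)) /\ @convex_set R ('rV[R]_d * R)%type (epi (h t))) /\
  (forall O : set ('rV[R]_d * R)%type, open O ->
     measurable [set t | time T t /\ epi (h t) `&` O !=set0]).

Definition integral_functional (R : realType) (d : nat) (T : \bar R)
    (mu : {measure set (\bar R) -> \bar R})
    (h : \bar R -> 'rV[R]_d -> \bar R) (y : \bar R -> 'rV[R]_d) : \bar R :=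
  conv_integral T mu (fun t => h t (y t)).

Definition dom_integral_functional (R : realType) (d : nat) (T : \bar R)
    (mu : {measure set (\bar R) -> \bar R})
    (h : \bar R -> 'rV[R]_d -> \bar R) : set (\bar R -> 'rV[R]_d) :=
  [set y | cadlag T y /\ (integral_functional T mu h y < +oo)%E].

Definition cl_dom (R : realType) (d : nat)
    (h : \bar R -> 'rV[R]_d -> \bar R) (t : \bar R) : set 'rV[R]_d :=
  closure (edom (h t)).

(* Main.v *)
Require Import Defs.

(** The inequality between the infimum over selections and the integral of the
    pointwise infimum is monotonicity of the integral, and it gives equality
    when the former is [-oo].  For the converse let [A] be the set of càdlàg
    selections of [S] whose integral functional is less than [+oo], and suppose
    that the infimum [L] of the functional is a real number, so that
    [h_t(y_t)] is integrable for every [y] in [A].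

    First, measurable selections are replaced by countably many elements of
    [A].  Càdlàg functions are right-continuous, and the topology of half-open
    intervals [[t, s)] is hereditarily Lindelöf ([sorgenfrey_lindelof]); hence
    any set of càdlàg functions contains a countable subset that is dense in it
    at every single time ([countable_pointwise_dense]).  The two closure
    hypotheses then give a sequence [Y_n] in [A] whose values are dense in
    [S_t] for every [t].  For almost every [t] all [h_t(Y_n(t))] are finite,
    and the infimum of a convex function over a dense subset of its domain is
    its global infimum ([convex_inf_dense]).  So
    [inf_x h_t(x) = inf_n h_t(Y_n(t))] almost everywhere.

    Next, finite minima are reached from inside [A].  Replacing [z] by [y] on a
    finite union of half-open intervals keeps a function càdlàg, keeps it a
    selection of [S], and keeps it in [A].  The sets on which such a
    replacement is possible form an algebra that generates the Borel sets, so
    the Borel set where [h_t(y_t) < h_t(z_t)] is approximated by them up to a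
    small integral of [|h_t(y_t)| + |h_t(z_t)|] ([switching_approximation]).
    Therefore the minimum of [h_t(y_t)] and [h_t(z_t)] lies in the
    L1-closure of the functions [h_t(w_t)], [w] in [A] ([switching_l1_min]).
    This closure is stable under minima ([l1_closure_min]), so it contains
    [min_(k <= n) h_t(Y_k(t))], whose integral is consequently at least [L].

    Monotone convergence in [n] ([integral_inf_ge]) concludes. *)

Set Implicit Arguments.
Unset Strict Implicit.
Unset Printing Implicit Defensive.

Local Open Scope classical_set_scope.
Local Open Scope ring_scope.

(** * Half-open intervals and càdlàg functions *)

(** Right endpoints range over a countable set that contains [+oo], because
    [+oo] is itself a time and has no larger rational. *)
Definition rational_endpoint (R : realType) (q : option rat) : \bar R :=
  if q is Some r then (ratr r)%:E else +oo%E.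

Lemma right_nbhs_rational (R : realType) (t : \bar R) (P : set (\bar R)) :
  (\forall s \near t, (t <= s)%E -> P s) ->
  exists q : option rat, (t <= rational_endpoint R q)%E /\
    forall s, (t <= s <= rational_endpoint R q)%E -> P s.
Proof.
case: t => [t| |].
- move=> nt; have /nbhs_ballP[e /= e0 H] :
      nbhs t (fun r : R => (t%:E <= r%:E)%E -> P r%:E) := nt.
  have [q] : exists q : rat, ratr q \in `]t, t + e[.
    by apply: rat_in_itvoo; rewrite ltrDl.
  rewrite in_itv/= => /andP[tq qe]; exists (Some q).
  split; first by rewrite lee_fin ltW.
  move=> [s| |] //=; rewrite ?leye_eq ?leNye_eq ?andbF// !lee_fin => /andP[ts sq].
  have /= : ball t e s.
    by rewrite /ball/= ler0_norm ?subr_le0// opprB ltrBlDl (le_lt_trans sq).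
  by move/H; apply; rewrite lee_fin.
- move=> [M [_ H]]; exists None; split => // s.
  by rewrite leye_eq => /andP[/eqP-> _]; apply: H; rewrite ?ltry.
- move=> [M [_ H]].
  have [q] : exists q : rat, ratr q \in `](M - 1), M[.
    by apply: rat_in_itvoo; rewrite ltrBlDr ltrDl.
  rewrite in_itv/= => /andP[_ qM]; exists (Some q).
  split; first by rewrite leNye.
  move=> s /andP[_ sq]; apply: H; last by rewrite leNye.
  by rewrite (le_lt_trans sq)// lte_fin.
Qed.

Lemma ereal_rat_between (R : realType) (t u : \bar R) :
  (t < u)%E -> exists q : rat, (t < (ratr q)%:E < u)%E.
Proof.
case: t => [t| |]; case: u => [u| |] //.
- by rewrite lte_fin => /rat_in_itvoo[q]; rewrite in_itv/=; exists q.
- move=> _; have [|q] := @rat_in_itvoo _ t (t + 1); first by rewrite ltrDl.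
  by rewrite in_itv/= => /andP[tq _]; exists q; rewrite lte_fin tq ltry.
- move=> _; have [|q] := @rat_in_itvoo _ (u - 1) u; first by rewrite gtrBl.
  by rewrite in_itv/= => /andP[_ tq]; exists q; rewrite lte_fin tq ltNyr.
- by exists 0; rewrite ltry ltNyr.
Qed.

Lemma countable_range (T : Type) (A : set T) :
  countable A -> A !=set0 -> exists f : nat -> T, range f = A.
Proof.
move=> /countable_injP[g g_inj] [a0 Aa0].
have /choice[f Hf] : forall n, exists a, A a /\ ((exists2 b, A b & g b = n) -> g a = n).
  move=> n; have [[b Ab gb]|nb] := pselect (exists2 b, A b & g b = n).
    by exists b.
  by exists a0; split => // -[b Ab gb]; case: nb; exists b.
exists f; apply/seteqP; split => [_ [n _ <-]|a Aa]; first exact: (Hf n).1.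
exists (g a) => //; have [Af Hg] := Hf (g a).
by apply: g_inj; rewrite ?inE//; apply: Hg; exists a.
Qed.

(** Group the points by the rational right endpoint [q] up to which their
    neighbourhood is good.  Inside one group, a point with a good point to its
    left is covered by any good point chosen to the left of a rational between
    the two; at most one point of the group, its minimum, has none.  One choice
    per pair of rationals and one per group thus suffice. *)
Lemma sorgenfrey_lindelof (R : realType) (U : set (\bar R))
    (N : \bar R -> set (\bar R)) :
  (forall t, U t -> exists q : option rat, (t <= rational_endpoint R q)%E /\
    forall s, (t <= s <= rational_endpoint R q)%E -> U s -> N t s) ->
  exists C : set (\bar R), [/\ countable C, C `<=` U & U `<=` \bigcup_(t in C) N t].
Proof.
move=> HN.
pose good (q : option rat) := [set t | U t /\
  forall s, (t <= s <= rational_endpoint R q)%E -> U s -> N t s].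
(* [None] selects the minimum of the group, when it exists. *)
pose pick (i : option rat * option rat) : set (\bar R) :=
  if i.2 is Some p then [set t | good i.1 t /\ (t < (ratr p)%:E)%E]
  else [set t | good i.1 t /\ forall s, good i.1 s -> (t <= s)%E].
pose C := U `&` range (fun i => xget -oo%E (pick i)).
exists C; split.
- apply: (@sub_countable _ _ _ (range (fun i => xget -oo%E (pick i)))).
    by apply: subset_card_le; exact: subIsetr.
  apply: (sub_countable (card_image_le _ _)); exact: countableP.
- by move=> t [].
move=> u Uu.
have [q [uq Hq]] := HN _ Uu.
have gu : good q u by split.
(* Is there a good point to the left of [u], or is [u] the minimum of its group? *)
have [[t [gt tu]]|nex] := pselect (exists t, good q t /\ (t < u)%E).
- have [p /andP[tp pu]] := ereal_rat_between tu.
  have /xgetPex : exists t, pick (q, Some p) t by exists t.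
  move=> /(_ -oo%E); set v := xget _ _ => -[gv vp].
  exists v; first by split; [case: gv|exists (q, Some p)].
  by apply: gv.2 => //; rewrite uq andbT ltW// (lt_trans vp).
- have /xgetPex : exists t, pick (q, None) t.
    exists u; split => // s gs; rewrite leNgt; apply/negP => su.
    by apply: nex; exists s.
  move=> /(_ -oo%E); set v := xget _ _ => -[gv vm].
  exists v; first by split; [case: gv|exists (q, None)].
  by apply: gv.2 => //; rewrite uq andbT vm.
Qed.

Lemma measurable_time (R : realType) (T : \bar R) : measurable (time T).
Proof.
rewrite (_ : time T = [set` `[0%E, T]]); first exact: emeasurable_itv.
by apply/seteqP; split => t /=; rewrite in_itv.
Qed.

(** The Lindelöf property writes such a set as a countable union of traces of
    closed intervals. *)
Lemma measurable_right_open (R : realType) (D U : set (\bar R)) :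
  measurable D -> U `<=` D ->
  (forall t, U t -> \forall s \near t, (t <= s)%E -> D s -> U s) -> measurable U.
Proof.
move=> mD UD HU.
have /choice[q Hq] : forall t, exists q : option rat, U t ->
    (t <= rational_endpoint R q)%E /\
    forall s, (t <= s <= rational_endpoint R q)%E -> D s -> U s.
  move=> t; have [Ut|] := pselect (U t); last by exists None.
  by have [q Hq] := right_nbhs_rational (HU t Ut); exists q.
pose N t := [set` `[t, rational_endpoint R (q t)]] `&` D.
have [|C [cC CU UC]] := @sorgenfrey_lindelof R U N.
  move=> t Ut; exists (q t); split; first exact: (Hq t Ut).1.
  by move=> s ts Us; split; [rewrite /= in_itv|exact: UD].
have -> : U = \bigcup_(t in C) N t.
  apply/seteqP; split => // u [t Ct [/=]]; rewrite in_itv/= => tu Du.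
  exact: (Hq t (CU _ Ct)).2 tu Du.
have [->|/set0P C0] := eqVneq C set0; first by rewrite bigcup_set0.
have [c <-] := countable_range cC C0; rewrite bigcup_image.
apply: bigcup_measurable => n _; apply: measurableI => //.
exact: emeasurable_itv.
Qed.

Lemma cadlag_right_near (R : realType) (d : nat) (T : \bar R)
    (y : \bar R -> 'rV[R]_d) (t : \bar R) (O : set 'rV[R]_d) :
  cadlag T y -> time T t -> nbhs (y t) O ->
  \forall s \near t, (t <= s)%E -> time T s -> O (y s).
Proof.
move=> [yr _] /andP[t0 tT] Oy.
have [tltT|Tt] := ltP t T; last first.
  apply: nearW => s ts /andP[_ sT].
  have -> : s = t by apply/eqP; rewrite eq_le ts (le_trans sT).
  exact: nbhs_singleton.
have : \forall s \near t, (t < s <= T)%E -> O (y s).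
  by have := yr t; rewrite t0 tltT => /(_ isT O Oy).
apply: filterS => s H ts /andP[_ sT].
move: ts; rewrite le_eqVlt => /predU1P[<-|ts]; first exact: nbhs_singleton.
by apply: H; rewrite ts.
Qed.

Lemma measurable_cadlag_preimage (R : realType) (d : nat) (T : \bar R)
    (y : \bar R -> 'rV[R]_d) (O : set 'rV[R]_d) :
  cadlag T y -> open O -> measurable (time T `&` y @^-1` O).
Proof.
move=> cy oO; apply: (@measurable_right_open _ (time T)); first exact: measurable_time.
  exact: subIsetl.
move=> t [Dt Ot].
have : \forall s \near t, (t <= s)%E -> time T s -> O (y s).
  by apply: cadlag_right_near => //; apply: open_nbhs_nbhs.
by apply: filterS => s H ts Ds; split => //; exact: H.
Qed.

Definition rational_point (R : realType) (d : nat) (r : 'rV[rat]_d) : 'rV[R]_d :=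
  map_mx ratr r.

Lemma rational_point_dense (R : realType) (d : nat) (x : 'rV[R]_d) (e : R) :
  0 < e -> exists r : 'rV[rat]_d, `|rational_point R r - x| < e.
Proof.
move=> e0.
have /choice[f Hf] : forall i, exists q : rat, ratr q \in `]x 0 i, x 0 i + e[.
  by move=> i; apply: rat_in_itvoo; rewrite ltrDl.
exists (\row_i f i).
have : ball x e (rational_point R (\row_i f i)).
  split => // i j; rewrite !mxE ord1 /ball/=.
  have := Hf j; rewrite in_itv/= => /andP[xf fx].
  by rewrite ltr0_norm ?subr_lt0// opprB ltrBlDl.
by rewrite mx_norm_ball /= /ball_ /= distrC.
Qed.

(** Fix a ball with rational centre and radius [1/(n+1)].  A member of [A] that
    lies in the ball at time [t] stays in it for a while after [t], so by the
    Lindelöf property countably many members serve all the times at which some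
    member of [A] is in the ball. *)
Lemma countable_pointwise_dense (R : realType) (d : nat) (T : \bar R)
    (A : set (\bar R -> 'rV[R]_d)) : A `<=` cadlag T ->
  exists B, [/\ countable B, B `<=` A & forall t y (e : R), time T t -> A y ->
    0 < e -> exists2 z, B z & `|y t - z t| < e].
Proof.
move=> cA.
pose close (i : 'rV[rat]_d * nat) (x : 'rV[R]_d) :=
  `|rational_point R i.1 - x| < i.2.+1%:R^-1.
pose U i := [set t | time T t /\ exists2 y, A y & close i (y t)].
have /choice[Y HY] : forall it : ('rV[rat]_d * nat) * \bar R,
    exists y, U it.1 it.2 -> A y /\ close it.1 (y it.2).
  move=> [i t]; have [[_ [y]]|] := pselect (U i t); first by exists y.
  by exists (fun=> 0).
have /choice[C HC] : forall i, exists C : set (\bar R),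
    [/\ countable C, C `<=` U i &
     U i `<=` \bigcup_(t in C) [set s | close i (Y (i, t) s)]].
  move=> i; apply: sorgenfrey_lindelof => t Ut.
  have [AY cY] := HY (i, t) Ut.
  have [|q [tq Hq]] := @right_nbhs_rational _ t
      [set s | time T s -> close i (Y (i, t) s)]; last first.
    by exists q; split => // s ts Us; apply: Hq => //; exact: Us.1.
  apply: (@cadlag_right_near _ _ _ _ _ (close i)) => //; [exact: cA|exact: Ut.1|].
  apply: open_nbhs_nbhs; split => //.
  rewrite /close -[X in open X]/(ball_ Num.norm _ _) -mx_norm_ball.
  exact: ball_open.
exists (\bigcup_i [set Y (i, t) | t in C i]); split.
- apply: bigcup_countable => [|i _]; first exact: countableP.
  by have [cC _ _] := HC i; apply: (sub_countable (card_image_le _ _)).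
- by move=> _ [i _ [t Ct <-]]; have [_ CU _] := HC i; apply: (HY (i, t) _).1; exact: CU.
- move=> t y e Tt Ay e0.
  have [n ne] : exists n : nat, n.+1%:R^-1 < e / 2.
    have e20 : 0 < e / 2 by rewrite divr_gt0.
    have [n _ Hn] := near_infty_natSinv_lt (PosNum e20).
    by exists n; exact: (Hn n (leqnn n)).
  have n0 : 0 < n.+1%:R^-1 :> R by [].
  have [r yr] := rational_point_dense (y t) n0.
  have [_ _ /(_ t)[|s Cs /= ys]] := HC (r, n); first by split => //; exists y.
  exists (Y (r, n, s)); first by exists (r, n) => //; exists s.
  rewrite -(subrKA (rational_point R r)) (splitr e) (le_lt_trans (ler_normD _ _))//.
  by rewrite ltrD// (lt_trans _ ne)// distrC.
Qed.

(** * Measurability of integrands along càdlàg functions *)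

Lemma open_setX (X Y : topologicalType) (A : set X) (B : set Y) :
  open A -> open B -> open (A `*` B).
Proof.
move=> oA oB; rewrite openE => -[x y] [/= Ax By].
by exists (A, B) => //; split; apply: open_nbhs_nbhs.
Qed.

(** As the epigraph is closed, [h_t(y_t) <= a] holds exactly when the epigraph
    meets every small ball around [(y_t, a)].  Moving the centre of the ball to
    a rational point near [y_t] turns this into countably many conditions on
    [y_t] and on the epigraph separately. *)
Lemma measurable_cadlag_integrand (R : realType) (d : nat) (T : \bar R)
    (h : \bar R -> 'rV[R]_d -> \bar R) (y : \bar R -> 'rV[R]_d) :
  convex_normal_integrand T h -> cadlag T y ->
  measurable_fun (time T) (fun t => h t (y t)).
Proof.
move=> [epi_closed epi_meas] cy.
have mD := measurable_time T.
suff mle (a : R) : measurable (time T `&` [set t | (h t (y t) <= a%:E)%E]).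
  apply: (measurability _ (ErealGenOInfty.measurableE R)) => //.
  move=> _ [_ [a ->] <-].
  rewrite (_ : _ `&` _ = time T `\` (time T `&` [set t | (h t (y t) <= a%:E)%E])).
    exact: measurableD.
  apply/seteqP; split => t /=; rewrite in_itv/= andbT.
    by move=> [Dt]; rewrite ltNge => /negP ah; split => // -[].
  by move=> [Dt nh]; split => //; rewrite ltNge; apply/negP => ah; exact: nh.
pose e (n : nat) : R := n.+1%:R^-1.
have e_gt0 n : 0 < e n by rewrite /e.
pose hit (n : nat) (r : 'rV[rat]_d) : set (\bar R) :=
  (time T `&` y @^-1` (ball (rational_point R r) (e n))) `&`
  [set t | time T t /\
     epi (h t) `&` (ball (rational_point R r) (e n) `*` ball a (e n)) !=set0].
have -> : time T `&` [set t | (h t (y t) <= a%:E)%E] = \bigcap_n \bigcup_r hit n r.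
  apply/seteqP; split => [t [Dt hta] n _|t Ht].
    have [r] := @rational_point_dense R d (y t) (e n) (e_gt0 n) => ry.
    have bry : ball (rational_point R r) (e n) (y t) by rewrite mx_norm_ball.
    exists r => //; split => //; split => //.
    by exists (y t, a); split => //; split => //=; exact: ballxx.
  have Dt : time T t by have [r _ [[]]] := Ht 0 I.
  split => //.
  suff : closure (epi (h t)) (y t, a).
    by rewrite -(closure_id _).1; [|exact: (epi_closed t Dt).1].
  move=> O /nbhs_ballP[r /= r0 rO].
  have r20 : 0 < r / 2 by rewrite divr_gt0.
  have [n _ /(_ n (leqnn n)) /= en] := near_infty_natSinv_lt (PosNum r20).
  have [q _ [[_ /= yq] [_ [[x b] [xb [/= xq ba]]]]]] := Ht n I.
  exists (x, b); split => //; apply: rO; split => /=.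
    rewrite (splitr r); apply: (@ball_triangle _ _ (rational_point R q)).
      by apply: ball_sym; apply: (le_ball (ltW en)).
    by apply: (le_ball (ltW en)).
  by apply: (le_ball _ ba); rewrite (le_trans (ltW en))// ler_pdivrMr// ler_peMr ?ltW// ltr1n.
apply: bigcap_measurableType => n _; apply: countable_bigcupT_measurable.
  exact: countableP.
move=> r; apply: measurableI.
  by apply: measurable_cadlag_preimage => //; exact: ball_open.
apply: epi_meas; apply: open_setX; exact: ball_open.
Qed.

(** The infimum is less than [a] exactly when the epigraph meets the open set of
    points at height less than [a]. *)
Lemma measurable_infimum_integrand (R : realType) (d : nat) (T : \bar R)
    (h : \bar R -> 'rV[R]_d -> \bar R) :
  convex_normal_integrand T h ->
  measurable_fun (time T) (fun t => ereal_inf [set h t x | x in [set: 'rV[R]_d]]).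
Proof.
move=> [_ epi_meas].
apply: (measurability _ (ErealGenInftyO.measurableE R)) => //.
move=> _ [_ [a ->] <-].
rewrite (_ : _ `&` _ = [set t | time T t /\
    epi (h t) `&` ([set: 'rV[R]_d] `*` [set b : R | b < a]) !=set0]).
  by apply: epi_meas; apply: open_setX; [exact: openT|exact: open_lt].
apply/seteqP; split => t /=; rewrite in_itv/=.
  move=> [Dt /ereal_inf_lt[_ [x _ <-] hxa]]; split => //.
  have [b hb ba] : exists2 b : R, (h t x <= b%:E)%E & b < a.
    case: (h t x) hxa => [r| |]//.
      by rewrite lte_fin => ra; exists r.
    by move=> _; exists (a - 1); rewrite ?leNye// gtrBl.
  by exists (x, b).
move=> [Dt [[x b] [/= xb [_ /= ba]]]]; split => //.
apply: (@le_lt_trans _ _ (h t x)); first by apply: ereal_inf_lbound; exists x.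
by apply: (le_lt_trans xb); rewrite lte_fin.
Qed.

(** * Infimum of a convex function over a dense part of its domain *)

(** This is the convex combination of [p0] and the [p i] whose weight at [p0] is
    [1 - \sum_i c i]; one point is split off at a time. *)
Lemma convex_set_sum (R : realType) (E : lmodType R) (K : set E) (p0 : E)
    (n : nat) (p : 'I_n -> E) (c : 'I_n -> R) :
  @convex_set R E K -> K p0 -> (forall i, K (p i)) -> (forall i, 0 <= c i) ->
  \sum_i c i <= 1 -> K (p0 + \sum_i c i *: (p i - p0)).
Proof.
move=> cK K0; elim: n p c => [|n IH] p c Kp c0 c1.
  by rewrite big_ord0 addr0.
have {}cK (a b : E) (l : R) : 0 <= l <= 1 -> K a -> K b -> K (l *: a + (1 - l) *: b).
  move=> /andP[l0 l1] Ka Kb; have /set_mem := cK a b (Itv01 l0 l1) (mem_set Ka) (mem_set Kb).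
  by [].
rewrite big_ord_recl in c1.
have cs0 : 0 <= \sum_(i < n) c (lift ord0 i) by apply: sumr_ge0 => i _.
set s := \sum_(i < n) _ in c1 cs0.
have c01 : c ord0 <= 1 by rewrite (le_trans _ c1)// lerDl.
rewrite big_ord_recl.
(* If the first weight is [1] there is nothing left to normalize by. *)
have [c0E|c0n1] := eqVneq (c ord0) 1.
  have s0 : s = 0 by apply/eqP; rewrite eq_le cs0 andbT; move: c1; rewrite c0E gerDl.
  rewrite big1 => [|i _]; first by rewrite c0E scale1r addr0 addrC subrK.
  move/eqP: s0; rewrite psumr_eq0// => /allP /(_ i).
  by rewrite mem_index_enum => /(_ isT) /eqP ->; rewrite scale0r.
have c1gt0 : 0 < 1 - c ord0 by rewrite subr_gt0 lt_neqAle c0n1.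
pose q := p0 + \sum_i (c (lift ord0 i) / (1 - c ord0)) *: (p (lift ord0 i) - p0).
have -> : p0 + (c ord0 *: (p ord0 - p0) +
    \sum_(i < n) c (lift ord0 i) *: (p (lift ord0 i) - p0)) =
    c ord0 *: p ord0 + (1 - c ord0) *: q.
  have -> : \sum_(i < n) c (lift ord0 i) *: (p (lift ord0 i) - p0) =
      (1 - c ord0) *: (q - p0).
    rewrite /q [p0 + _]addrC addrK scaler_sumr; apply: eq_bigr => i _.
    by rewrite scalerA mulrCA divff ?mulr1// gt_eqF.
  rewrite !scalerBr addrACA -opprD -scalerDl [c ord0 + _]addrC subrK scale1r.
  by rewrite [LHS]addrC subrK.
apply: cK; [by rewrite c0 c01|exact: Kp|].
apply: (IH (fun i => p (lift ord0 i)) (fun i => c (lift ord0 i) / (1 - c ord0))) => //.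
  by move=> i; rewrite divr_ge0// ltW.
by rewrite -mulr_suml ler_pdivrMr// mul1r lerBrDl.
Qed.

(** Rows taken from [X] that reach the maximal rank span all of [X]. *)
Lemma spanning_rows (F : fieldType) (d : nat) (X : set 'rV[F]_d) :
  exists n (B : 'M[F]_(n, d)), (forall i, X (row i B)) /\
    forall u, X u -> (u <= B)%MS.
Proof.
pose P r := `[< exists n (B : 'M[F]_(n, d)), (forall i, X (row i B)) /\ \rank B = r >].
have P0 : exists r, P r.
  by exists 0%N; apply/asboolP; exists 0%N, 0; split; [case|exact: mxrank0].
have Pd r : P r -> (r <= d)%N.
  by move=> /asboolP[n [B [_ <-]]]; exact: rank_leq_col.
have [r /asboolP[n [B [XB rB]]] rmax] := ex_maxnP P0 Pd.
exists n, B; split => // u Xu.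
have XBu i : X (row i (col_mx B u)).
  case: (split_ordP i) => j ->; first by rewrite rowKu.
  by rewrite rowKd (ord1 j) row_id.
have rBu : (\rank (col_mx B u) <= \rank B)%N.
  by rewrite rB; apply: rmax; apply/asboolP; exists (n + 1)%N, (col_mx B u).
have BBu : (B <= col_mx B u)%MS by rewrite -addsmxE addsmxSl.
have : (col_mx B u <= B)%MS by rewrite -(mxrank_leqif_sup BBu).2 eqn_leq mxrankS.
by apply: submx_trans; rewrite -addsmxE addsmxSr.
Qed.

Lemma sum_pair (U V : nmodType) (n : nat) (F : 'I_n -> U) (G : 'I_n -> V) :
  \sum_i (F i, G i) = (\sum_i F i, \sum_i G i).
Proof. by elim/big_rec3: _ => // i u v _ _ ->. Qed.

(** Relative interiors are avoided as follows.  Let [x] be in the domain and let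
    [x + u_i], with [u_i] the rows of [B], be finitely many points of [D] such
    that the [u_i] span all differences [y - x], [y] in [D].  The point
    [z = x + l * sum_i u_i] is in the domain for small [l > 0], so some [y] in
    [D] is close to it.  Then [y - z] is in the span of the [u_i] with small
    coefficients, hence [y = x + sum_i c_i u_i] with [0 <= c_i <= 2 l].
    Convexity bounds [f y] by [f x] plus a multiple of [l]. *)
Lemma convex_inf_dense (R : realType) (d : nat) (f : 'rV[R]_d -> \bar R)
    (D : set 'rV[R]_d) :
  @convex_set R ('rV[R]_d * R)%type (epi f) -> D `<=` edom f ->
  edom f `<=` closure D ->
  ereal_inf [set f x | x in D] = ereal_inf [set f x | x in [set: 'rV[R]_d]].
Proof.
move=> cf Df fD; apply/eqP; rewrite eq_le; apply/andP; split; last first.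
  by apply: ereal_inf_le_tmp => _ [x _ <-]; exists x.
apply: le_ereal_inf_tmp => _ [x _ <-].
suff near_x (a e : R) : (f x <= a%:E)%E -> 0 < e -> exists2 y, D y & (f y <= (a + e)%:E)%E.
  have inf_le a : (f x <= a%:E)%E -> (ereal_inf [set f x | x in D] <= a%:E)%E.
    move=> fxa; apply/lee_addgt0Pr => e e0.
    have [y Dy fy] := near_x _ _ fxa e0.
    by apply: le_trans fy; apply: ereal_inf_lbound; exists y.
  case: (f x) inf_le => [r| |] inf_le; [exact: inf_le|exact: leey|].
  rewrite leeNy_eq; apply/eqP/eq_ninfty => a; apply: inf_le; exact: leNye.
move=> fxa e0.
have [n [B [DB spanB]]] := spanning_rows [set u | D (x + u)].
have /choice[M fM] : forall i : 'I_n, exists b : R, (f (x + row i B)%R <= b%:E)%E.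
  move=> i; have := Df _ (DB i); rewrite /edom/=.
  case: (f _) => [r _|//|_]; [by exists r|by exists 0; exact: leNye].
pose S := \sum_i `|M i - a|.
have S0 : 0 <= S by apply: sumr_ge0.
(* [l] makes the weights at most [1] in total and the increase of [f] at most [e]. *)
pose l := (n.+1%:R + S / e)^-1 / 2.
have den0 : 0 < n.+1%:R + S / e by rewrite ltr_wpDr// divr_ge0// ltW.
have l0 : 0 < l by rewrite divr_gt0// invr_gt0.
have l2 : 2 * l = (n.+1%:R + S / e)^-1 by rewrite /l mulrCA divff ?mulr1.
have ln : 2 * l * n%:R <= 1.
  rewrite l2 mulrC ler_pdivrMr// mul1r (le_trans (_ : _ <= n.+1%:R)) ?ler_nat//.
  by rewrite lerDl divr_ge0// ltW.
have lS : 2 * l * S <= e.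
  rewrite l2 mulrC ler_pdivrMr// mulrDr mulrCA divff ?gt_eqF// mulr1.
  by rewrite lerDr mulr_ge0// ltW.
have comb (c : 'I_n -> R) : (forall i, 0 <= c i <= 2 * l) ->
    (f (x + \sum_i c i *: row i B)%R <= (a + e)%:E)%E.
  move=> c0l.
  have c1 : \sum_i c i <= 1.
    apply: le_trans ln; rewrite mulr_natr -[X in _ *+ X](card_ord n) -sumr_const.
    by apply: ler_sum => i _; case/andP: (c0l i).
  have := @convex_set_sum R ('rV[R]_d * R)%type (epi f) (x, a) n
    (fun i => (x + row i B, M i)) c cf fxa fM (fun i => (andP (c0l i)).1) c1.
  rewrite (_ : _ + _ = (x + \sum_i c i *: row i B, a + \sum_i c i * (M i - a))).
    move=> fle; apply: (le_trans fle); rewrite lee_fin lerD2l.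
    apply: le_trans lS; rewrite mulr_sumr; apply: ler_sum => i _.
    have /andP[ci0 ci1] := c0l i.
    by rewrite (le_trans (ler_norm _))// normrM ger0_norm// ler_wpM2r.
  rewrite [X in _ + X](_ : _ = (\sum_i c i *: row i B, \sum_i c i * (M i - a)))//.
  rewrite -sum_pair; apply: eq_bigr => i _.
  by apply: injective_projections => //=; rewrite [x + _]addrC addrK.
have fz : (f (x + \sum_i l *: row i B)%R < +oo)%E.
  by apply: (le_lt_trans (comb _ _)); rewrite ?ltry// => i; rewrite ltW//= ler_peMl// ?ler1n// ltW.
(* [K] bounds the coefficients [c] by the norm of [y - z]; the [1] keeps it positive. *)
pose K := 1 + \sum_k \sum_j `|pinvmx B k j|.
have K0 : 0 < K by rewrite ltr_wpDr// sumr_ge0// => k _; rewrite sumr_ge0.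
have [y [Dy zy]] := fD _ fz _ (nbhsx_ballx _ (l / K) (divr_gt0 l0 K0)).
exists y => //.
set z := x + _ in fz zy.
pose c := (y - z) *m pinvmx B.
have cE : y - z = c *m B.
  rewrite mulmxKpV//.
  rewrite (_ : y - z = (y - x) - (z - x)); last by rewrite opprB addrA subrK.
  rewrite addmx_sub//; first by apply: spanB; rewrite /= addrC subrK.
  rewrite eqmx_opp /z addrAC subrr add0r summx_sub// => i _.
  by rewrite scalemx_sub// row_sub.
have cl j : `|c 0 j| <= l.
  have [_ {}zy] : ball z (l / K) y := zy.
  rewrite mxE (le_trans (ler_norm_sum _ _ _))//.
  apply: (@le_trans _ _ (\sum_k (l / K) * `|pinvmx B k j|)).
    apply: ler_sum => k _; rewrite normrM ler_wpM2r//.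
    rewrite mxE [(- z) _ _]mxE distrC ltW//; exact: zy.
  rewrite -mulr_sumr mulrAC ler_pdivrMr// ler_wpM2l ?(ltW l0)// /K.
  rewrite ler_wpDl//.
  apply: ler_sum => k _; rewrite (bigD1 j)//= lerDl; exact: sumr_ge0.
have -> : y = x + \sum_i (l + c 0 i) *: row i B.
  under eq_bigr do rewrite scalerDl.
  by rewrite big_split/= -mulmx_sum_row addrA -/z -cE addrC subrK.
apply: comb => i; have := cl i; rewrite ler_norml => /andP[c1 c2].
by rewrite -lerBlDl sub0r c1/= mulr_natl mulr2n lerD2l.
Qed.

(** * Approximation of measurable sets by a generating algebra *)

(** The sets that can be approximated form a sigma-algebra: for a countable
    union, approximate a finite union that carries almost the whole integral. *)
Lemma algebra_approximation d (X : measurableType d) (R : realType)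
    (mu : {measure set X -> \bar R}) (D : set X) (g : X -> \bar R)
    (V : set (set X)) :
  measurable D -> mu.-integrable D g -> (forall x, D x -> (0 <= g x)%E) ->
  V `<=` measurable -> V set0 -> (forall A, V A -> V (~` A)) ->
  (forall A B, V A -> V B -> V (A `|` B)) -> measurable `<=` <<s V >> ->
  forall (E : set X) (e : R), measurable E -> 0 < e ->
  exists2 W, V W & (\int[mu]_(x in D `&` (E `+` W)) g x < e%:E)%E.
Proof.
move=> mD ig g0 Vm V0 VC VU Vgen.
pose nu A := (\int[mu]_(x in D `&` A) g x)%E.
have mg : measurable_fun D g by exact: measurable_int ig.
have nu_le A B : measurable A -> measurable B -> A `<=` B -> (nu A <= nu B)%E.
  move=> mA mB AB; apply: ge0_subset_integral; [exact: measurableI|exact: measurableI| | |].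
  - by apply: measurable_funS mg => //; exact: subIsetl.
  - by move=> x [Dx _]; exact: g0.
  - exact: setIS.
have nuD A B : measurable A -> measurable B -> A `<=` B ->
    nu B = (nu A + nu (B `\` A))%E.
  move=> mA mB AB; rewrite /nu -[in LHS](setDUK AB) setIUr ge0_integral_setU//.
  - exact: measurableI.
  - by apply: measurableI => //; exact: measurableD.
  - by apply: measurable_funS mg => //; rewrite -setIUr; exact: subIsetl.
  - by move=> x [|] [Dx _]; exact: g0.
  - by rewrite disj_set2E setIACA setDIK setI0.
have nuU A B : measurable A -> measurable B -> (nu (A `|` B) <= nu A + nu B)%E.
  move=> mA mB; have mAB := measurableU _ _ mA mB.
  rewrite (@nuD A (A `|` B))//.
  by rewrite leeD2l// nu_le//; [exact: measurableD|move=> x [[]]].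
have nu_fin A : measurable A -> nu A \is a fin_num.
  move=> mA; apply: integrable_fin_num; first exact: measurableI.
  by apply: integrableS ig => //; exact: measurableI.
pose good := [set E | measurable E /\ forall e : R, 0 < e ->
  exists2 W, V W & (nu (E `+` W) < e%:E)%E].
have mY (A B : set X) : measurable A -> measurable B -> measurable (A `+` B).
  by move=> mA mB; exact: (measurableU _ _ (measurableD mA mB) (measurableD mB mA)).
have goodV A : V A -> good A.
  move=> VA; split; first exact: Vm.
  by move=> e e0; exists A => //; rewrite setYK /nu setI0 integral_set0.
have goodU A B : good A -> good B -> good (A `|` B).
  move=> [mA HA] [mB HB]; split; first exact: measurableU.
  move=> e e0; have e20 : 0 < e / 2 by rewrite divr_gt0.
  have [A' VA' AA'] := HA _ e20; have [B' VB' BB'] := HB _ e20.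
  have [mA' mB'] := (Vm _ VA', Vm _ VB').
  exists (A' `|` B'); first exact: VU.
  apply: (@le_lt_trans _ _ (nu ((A `+` A') `|` (B `+` B')))).
    apply: nu_le.
    - by apply: mY; exact: measurableU.
    - by apply: measurableU; exact: mY.
    - by move=> x; rewrite !setY_def /=; tauto.
  rewrite (le_lt_trans (nuU _ _ _ _))//; [exact: mY|exact: mY|].
  by rewrite [e]splitr EFinD lteD.
have goodS : sigma_algebra setT good.
  split; first exact: goodV.
  - move=> A [mA HA]; rewrite setTD; split; first exact: measurableC.
    move=> e /HA[W VW AW]; exists (~` W); first exact: VC.
    rewrite (_ : ~` A `+` ~` W = A `+` W)//; apply/seteqP; split => x /=;
      by have := pselect (A x); have := pselect (W x); tauto.
  - move=> F gF; have mF n : measurable (F n) by exact: (gF n).1.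
    split; first exact: bigcup_measurable.
    move=> e e0; have e20 : 0 < e / 2 by rewrite divr_gt0.
    pose U n := \big[setU/set0]_(i < n.+1) F i.
    have gU n : good (U n) by apply: (big_ind good) => //; exact: goodV.
    have UF : \bigcup_n F n = \bigcup_n U n by rewrite bigcup_bigsetU_bigcup.
    have ndU : nondecreasing_seq U.
      by move=> m n mn; rewrite subsetEset; exact: (@subset_bigsetU _ F m.+1 n.+1 mn).
    have : nu (U n) @[n --> \oo] --> nu (\bigcup_n F n).
      rewrite /nu UF setI_bigcupr; apply: ge0_nondecreasing_set_cvg_integral.
      + by move=> m n mn; rewrite subsetEset; apply: setIS; rewrite -subsetEset; exact: ndU.
      + by move=> n; apply: measurableI => //; exact: (gU n).1.
      + by move=> n; apply: measurable_funS mg => //; exact: subIsetl.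
      + by move=> n x [Dx _]; exact: g0.
    move=> cvgU.
    have [n Un] : exists n, (nu (\bigcup_n F n `\` U n) < (e / 2)%:E)%E.
      have mUF : measurable (\bigcup_n F n) by exact: bigcup_measurable.
      have /cvgU[n _ /(_ n (leqnn n)) /= nn] : nbhs (nu (\bigcup_n F n))
          [set u | (nu (\bigcup_n F n) - (e / 2)%:E < u)%E].
        by apply: open_ereal_gt'; rewrite lteBlDr// lteDl ?nu_fin ?lte_fin.
      have mUn := (gU n).1; exists n.
      have UnF : U n `<=` \bigcup_n F n by rewrite UF => x Ux; exists n.
      have := nn; rewrite (nuD _ _ mUn mUF UnF) => {}nn.
      by rewrite EFinN lteBlDr// lteD2lE ?nu_fin// in nn.
    have [W VW UW] := (gU n).2 _ e20.
    exists W => //; apply: (@le_lt_trans _ _ (nu ((\bigcup_n F n `\` U n) `|` (U n `+` W)))).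
      apply: nu_le.
      + by apply: mY; [exact: bigcup_measurable|exact: Vm].
      + apply: measurableU; last by apply: mY; [exact: (gU n).1|exact: Vm].
        by apply: measurableD; [exact: bigcup_measurable|exact: (gU n).1].
      + move=> x; rewrite !setY_def /=.
        have : U n x -> (\bigcup_n F n) x by rewrite UF => Ux; exists n.
        have := pselect (U n x); rewrite /setD/=; tauto.
    rewrite (le_lt_trans (nuU _ _ _ _))//.
    + by apply: measurableD; [exact: bigcup_measurable|exact: (gU n).1].
    + by apply: mY; [exact: (gU n).1|exact: Vm].
    + by rewrite [e]splitr EFinD lteD.
move=> E e mE e0.
have : good E by apply: (smallest_sub goodS _ (Vgen _ mE)); exact: goodV.
by move=> [_ /(_ _ e0)].
Qed.

(** * Switching between càdlàg functions *)

(** These sets stand for the finite unions of half-open intervals: in this form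
    they contain the rays [[x, +oo)], which generate the Borel sets, and
    stability under complements and unions is immediate. *)
Definition cadlag_switching (R : realType) (d : nat) (T : \bar R) : set (set (\bar R)) :=
  [set V | measurable V /\ forall y z : \bar R -> 'rV[R]_d,
    cadlag T y -> cadlag T z -> cadlag T (patch z V y)].

Lemma within_cvg_eq (R : realType) (d : nat) (t : \bar R) (D : set (\bar R))
    (f g : \bar R -> 'rV[R]_d) (l : 'rV[R]_d) :
  (\forall s \near t, D s -> f s = g s) ->
  g s @[s --> within D (nbhs t)] --> l -> f s @[s --> within D (nbhs t)] --> l.
Proof.
move=> fg; apply: cvg_trans; apply: near_eq_cvg.
by apply: filterS fg => s fg Ds; rewrite fg.
Qed.

Lemma cadlag_switching_ray (R : realType) (d : nat) (T : \bar R) (x : R) :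
  cadlag_switching d T `[x%:E, +oo[%classic.
Proof.
split; first exact: emeasurable_itv.
move=> y z [yr yl] [zr zl].
have inV s : (s \in `[x%:E, +oo[%classic) = (x%:E <= s)%E.
  by apply/idP/idP; rewrite inE/= in_itv/= andbT.
split => t Dt.
  rewrite /patch inV; case: ifPn => [xt|]; last rewrite -ltNge => tx.
    apply: within_cvg_eq (yr t Dt); apply: nearW => s /andP[ts _].
    by rewrite inV (le_trans xt)// ltW.
  apply: within_cvg_eq (zr t Dt).
  have : nbhs t [set s | (s < x%:E)%E] by exact: open_ereal_lt'.
  by apply: filterS => s sx _; rewrite inV leNgt sx.
have [tx|xt] := leP t x%:E.
  have [l zlt] := zl t Dt; exists l; apply: within_cvg_eq zlt.
  apply: nearW => s /andP[_ st].
  by rewrite /patch inV leNgt (lt_le_trans st).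
have [l ylt] := yl t Dt; exists l; apply: within_cvg_eq ylt.
have : nbhs t [set s | (x%:E < s)%E] by exact: open_ereal_gt'.
by apply: filterS => s xs _; rewrite /patch inV ltW.
Qed.

Lemma cadlag_switchingC (R : realType) (d : nat) (T : \bar R) (V : set (\bar R)) :
  cadlag_switching d T V -> cadlag_switching d T (~` V).
Proof.
move=> [mV HV]; split; first exact: measurableC.
move=> y z cy cz.
rewrite (_ : patch z (~` V) y = patch y V z); first exact: HV.
by apply/funext => t; rewrite /patch in_setC; case: (t \in V).
Qed.

Lemma cadlag_switchingU (R : realType) (d : nat) (T : \bar R) (V W : set (\bar R)) :
  cadlag_switching d T V -> cadlag_switching d T W ->
  cadlag_switching d T (V `|` W).
Proof.
move=> [mV HV] [mW HW]; split; first exact: measurableU.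
move=> y z cy cz.
rewrite (_ : patch z (V `|` W) y = patch (patch z W y) V y).
  by apply: HV => //; exact: HW.
by apply/funext => t; rewrite /patch in_setU; case: (t \in V).
Qed.

Lemma cadlag_switching0 (R : realType) (d : nat) (T : \bar R) :
  @cadlag_switching R d T set0.
Proof.
split => // y z cy cz; rewrite (_ : patch z set0 y = z)//.
by apply/funext => t; rewrite /patch in_set0.
Qed.

Lemma measurable_generated_by_switching (R : realType) (d : nat) (T : \bar R) :
  (measurable : set (set (\bar R))) `<=` <<s @cadlag_switching R d T >>.
Proof.
rewrite [X in X `<=` _](ErealGenCInfty.measurableE R).
apply: sub_sigma_algebra2; move=> _ [x ->].
exact: cadlag_switching_ray.
Qed.

Lemma switching_approximation (R : realType) (d : nat) (T : \bar R)
    (mu : {measure set (\bar R) -> \bar R}) (g : \bar R -> \bar R)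
    (E : set (\bar R)) (e : R) :
  mu.-integrable (time T) g -> (forall t, time T t -> (0 <= g t)%E) ->
  measurable E -> 0 < e ->
  exists2 V, cadlag_switching d T V &
    (\int[mu]_(t in time T `&` (E `+` V)) g t < e%:E)%E.
Proof.
move=> ig g0; apply: algebra_approximation => //.
- exact: measurable_time.
- by move=> V [].
- exact: cadlag_switching0.
- by move=> V; exact: cadlag_switchingC.
- by move=> V W; exact: cadlag_switchingU.
- exact: measurable_generated_by_switching.
Qed.

(** * Decreasing sequences of integrable functions *)

(** Monotone convergence for the gaps [m 0 - m n], whose integrals are at most
    the integral of [m 0] minus [L]; this also shows that the limit gap is
    integrable. *)
Lemma integral_inf_ge d (X : measurableType d) (R : realType)
    (mu : {measure set X -> \bar R}) (D : set X) (m : nat -> X -> R)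
    (phi : X -> \bar R) (L : R) :
  measurable D -> (forall x, D x -> nonincreasing_seq (fun n => m n x)) ->
  (forall n, mu.-integrable D (EFin \o m n)) ->
  (forall n, (L%:E <= \int[mu]_(x in D) (m n x)%:E)%E) ->
  measurable_fun D phi ->
  {ae mu, forall x, D x -> phi x = ereal_inf (range (fun n => (m n x)%:E))} ->
  (L%:E <= \int[mu]_(x in D) phi x)%E.
Proof.
move=> mD ni_m im Lm mphi phiE.
pose gap n x := ((m 0%N x)%:E - (m n x)%:E)%E.
have igap n : mu.-integrable D (gap n) by exact: (integrableB mD (im 0%N) (im n)).
have mgap n : measurable_fun D (gap n) by exact: measurable_int (igap n).
have gap0 n x : D x -> (0 <= gap n x)%E.
  by move=> Dx; rewrite /gap -EFinB lee_fin subr_ge0; exact: ni_m.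
have nd_gap x : D x -> nondecreasing_seq (gap^~ x).
  by move=> Dx n k nk; rewrite /gap -!EFinB lee_fin lerB//; exact: ni_m.
pose C := (\int[mu]_(x in D) (m 0%N x)%:E - L%:E)%E.
have fin0 : (\int[mu]_(x in D) (m 0%N x)%:E)%E \is a fin_num.
  exact: (integrable_fin_num mD (im 0%N)).
have gapC n : (\int[mu]_(x in D) gap n x <= C)%E.
  by rewrite (integralB_EFin mD (im 0%N) (im n)) leeB.
pose G x := limn (gap^~ x).
have cvgG x : D x -> gap n x @[n --> \oo] --> G x.
  by move=> Dx; apply: ereal_nondecreasing_is_cvgn; exact: nd_gap.
have mG : measurable_fun D G.
  by apply: emeasurable_fun_cvg mgap _ => x Dx; exact: cvgG.
have G0 x : D x -> (0 <= G x)%E.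
  move=> Dx; apply: lime_ge; first exact: cvgG.
  by apply: nearW => n; exact: gap0.
have GC : (\int[mu]_(x in D) G x <= C)%E.
  rewrite monotone_convergence//.
  apply: lime_le; last by apply: nearW.
  apply: ereal_nondecreasing_is_cvgn => n k nk.
  by apply: ge0_le_integral => // x Dx; [exact: gap0|exact: nd_gap].
have iG : mu.-integrable D G.
  apply/integrableP; split => //.
  rewrite (eq_integral G) => [|x /set_mem Dx]; last by rewrite gee0_abs// G0.
  by rewrite (le_lt_trans GC)// /C -(fineK fin0) -EFinB ltry.
have -> : (\int[mu]_(x in D) phi x = \int[mu]_(x in D) ((m 0%N x)%:E - G x))%E.
  apply: ae_eq_integral => //.
    by apply: emeasurable_funB => //; exact: measurable_int (im 0%N).
  apply: filterS phiE => x phiE Dx; rewrite phiE//.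
  have cvg_inf : (m n x)%:E @[n --> \oo] --> ereal_inf (range (fun n => (m n x)%:E)).
    by apply: ereal_nonincreasing_cvgn => n k nk; rewrite lee_fin; exact: ni_m.
  have -> : G x = ((m 0%N x)%:E - ereal_inf (range (fun n => (m n x)%:E)))%E.
    apply/cvg_lim => //; apply: cvgeB => //; exact: cvg_cst.
  by rewrite oppeB// addeA subee// add0e.
rewrite (integralB mD (im 0%N) iG).
rewrite leeBrDr ?(integrable_fin_num mD iG)//.
by rewrite addeC -leeBrDr.
Qed.

(** * Minima in the L1-closure of a set of functions *)

(** Integrability of the limit is part of the definition, so that integrals of
    members can be compared. *)
Definition l1_closure d (X : measurableType d) (R : realType)
    (mu : {measure set X -> \bar R}) (D : set X) (F : set (X -> R)) : set (X -> R) :=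
  [set m | mu.-integrable D (EFin \o m) /\ forall e : R, 0 < e ->
    exists2 f, F f & (\int[mu]_(x in D) `|f x - m x|%:E < e%:E)%E].

Lemma measurable_integrable_EFin d (X : measurableType d) (R : realType)
    (mu : {measure set X -> \bar R}) (D : set X) (f : X -> R) :
  mu.-integrable D (EFin \o f) -> measurable_fun D f.
Proof. by move=> intf; apply/measurable_EFinP; exact: measurable_int intf. Qed.

Lemma integrable_min d (X : measurableType d) (R : realType)
    (mu : {measure set X -> \bar R}) (D : set X) (f g : X -> R) :
  measurable D -> mu.-integrable D (EFin \o f) -> mu.-integrable D (EFin \o g) ->
  mu.-integrable D (EFin \o (f \min g)).
Proof.
move=> mD intf intg.
have := integrableD mD (integrable_norm intf) (integrable_norm intg).
apply: le_integrable => //.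
  apply/measurable_EFinP; apply: measurable_minr.
    exact: measurable_integrable_EFin intf.
  exact: measurable_integrable_EFin intg.
move=> x Dx; rewrite /= lee_fin [leRHS]ger0_norm ?addr_ge0//.
by case: (leP (f x) (g x)) => _; rewrite ?lerDl ?lerDr.
Qed.

Lemma dist_min (R : realDomainType) (a b a' b' : R) :
  `|Num.min a b - Num.min a' b'| <= `|a - a'| + `|b - b'|.
Proof.
have Dab (x y : R) : Num.min x y <= x /\ Num.min x y <= y.
  by rewrite !ge_min !lexx orbT.
suff le1 (x y x' y' : R) : Num.min x y - Num.min x' y' <= `|x - x'| + `|y - y'|.
  by rewrite ler_norml le1 andbT lerNl opprB (le_trans (le1 _ _ _ _))// !(distrC a') !(distrC b').
have [x'y'|y'x'] := leP x' y'.
  by rewrite (@le_trans _ _ (x - x')) ?lerB ?(Dab x y).1// (le_trans (ler_norm _))// lerDl.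
by rewrite (@le_trans _ _ (y - y')) ?lerB ?(Dab x y).2// (le_trans (ler_norm _))// lerDr.
Qed.

(** The minimum is 1-Lipschitz in each argument, so it suffices to approximate
    both functions and then the minimum of their approximations. *)
Lemma l1_closure_min d (X : measurableType d) (R : realType)
    (mu : {measure set X -> \bar R}) (D : set X) (F : set (X -> R)) (m m' : X -> R) :
  measurable D -> (forall f, F f -> mu.-integrable D (EFin \o f)) ->
  (forall f g, F f -> F g -> l1_closure mu D F (f \min g)) ->
  l1_closure mu D F m -> l1_closure mu D F m' -> l1_closure mu D F (m \min m').
Proof.
move=> mD intF Fmin [im Hm] [im' Hm']; split; first exact: integrable_min.
move=> e e0; have e20 : 0 < e / 2 by rewrite divr_gt0.
have e40 : 0 < e / 2 / 2 by rewrite divr_gt0.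
have [f Ff fm] := Hm _ e40; have [g Fg gm'] := Hm' _ e40.
have [ifg /(_ _ e20)[k Fk kfg]] := Fmin _ _ Ff Fg.
exists k => //.
have ik := intF _ Fk; have iff := intF _ Ff; have igg := intF _ Fg.
have mdist (u v : X -> R) : mu.-integrable D (EFin \o u) -> mu.-integrable D (EFin \o v) ->
    measurable_fun D (fun x => `|u x - v x|%:E).
  move=> iu iv; apply/measurable_EFinP; apply: measurableT_comp => //.
  by apply: measurable_funB;
    [exact: measurable_integrable_EFin iu|exact: measurable_integrable_EFin iv].
apply: (@le_lt_trans _ _ (\int[mu]_(x in D) (`|k x - (f \min g) x|%:E +
    (`|f x - m x|%:E + `|g x - m' x|%:E)))%E).
  apply: ge0_le_integral => //.
  - by apply: mdist => //; exact: integrable_min.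
  - by apply: emeasurable_funD; [exact: mdist|apply: emeasurable_funD; exact: mdist].
  - move=> x Dx; rewrite -!EFinD lee_fin.
    rewrite (le_trans (ler_distD ((f \min g) x) _ _))// lerD2l; exact: dist_min.
rewrite ge0_integralD//.
- rewrite ge0_integralD//; [|exact: mdist|exact: mdist].
  have -> : e%:E = ((e / 2)%:E + ((e / 2 / 2)%:E + (e / 2 / 2)%:E))%E.
    by rewrite -!EFinD -!splitr.
  by rewrite !lteD.
- exact: mdist.
- by move=> x _; rewrite adde_ge0.
- by apply: emeasurable_funD; exact: mdist.
Qed.

(** The integral is continuous for the L1-distance. *)
Lemma l1_closure_integral_ge d (X : measurableType d) (R : realType)
    (mu : {measure set X -> \bar R}) (D : set X) (F : set (X -> R)) (L : R)
    (m : X -> R) :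
  measurable D -> (forall f, F f -> mu.-integrable D (EFin \o f)) ->
  (forall f, F f -> (L%:E <= \int[mu]_(x in D) (f x)%:E)%E) ->
  l1_closure mu D F m -> (L%:E <= \int[mu]_(x in D) (m x)%:E)%E.
Proof.
move=> mD intF LF [im Hm].
apply/lee_addgt0Pr => e /Hm[f Ff fm].
have iff := intF _ Ff.
apply: (le_trans (LF _ Ff)).
rewrite addeC -leeBlDr ?(integrable_fin_num mD im)//.
rewrite -(integralB_EFin mD iff im).
apply: ltW; apply: le_lt_trans fm.
apply: (le_trans (lee_abs _)).
apply: (@le_abse_integral _ _ _ _ _ (fun x => (f x)%:E - (m x)%:E)%E mD).
exact: (measurable_int _ (integrableB mD iff im)).
Qed.

Fixpoint running_min (R : realType) (a : nat -> R) (n : nat) : R :=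
  if n is k.+1 then Num.min (running_min a k) (a n) else a 0%N.

Lemma running_min_nonincreasing (R : realType) (a : nat -> R) :
  nonincreasing_seq (running_min a).
Proof. by apply/nonincreasing_seqP => n /=; rewrite ge_min lexx. Qed.

Lemma running_min_inf (R : realType) (a : nat -> R) :
  ereal_inf (range (fun n => (running_min a n)%:E)) =
  ereal_inf (range (fun n => (a n)%:E)).
Proof.
apply/eqP; rewrite eq_le; apply/andP; split; apply: le_ereal_inf_tmp => _ [n _ <-].
  apply: (@le_trans _ _ (running_min a n)%:E).
    by apply: ereal_inf_lbound; exists n.
  by rewrite lee_fin; case: n => //= n; rewrite ge_min lexx orbT.
have [k ->] : exists k, running_min a n = a k.
  elim: n => [|n [k IH]]; first by exists 0%N.
  rewrite /= minEle IH; case: ifP => _; [by exists k|by exists n.+1].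
by apply: ereal_inf_lbound; exists k.
Qed.

(** * The integral with value +oo when the positive part is not integrable *)

Lemma conv_integralE (R : realType) (T : \bar R)
    (mu : {measure set (\bar R) -> \bar R}) (f : \bar R -> \bar R) :
  mu.-integrable (time T) f^\+%E ->
  conv_integral T mu f = (\int[mu]_(t in time T) f t)%E.
Proof. by move=> fp; rewrite /conv_integral asboolT. Qed.

Lemma conv_integral_lty (R : realType) (T : \bar R)
    (mu : {measure set (\bar R) -> \bar R}) (f : \bar R -> \bar R) :
  (conv_integral T mu f < +oo)%E <-> mu.-integrable (time T) f^\+%E.
Proof.
split=> [|fp]; first by rewrite /conv_integral; case: asboolP.
rewrite conv_integralE// integralE.
have fp_lty : (\int[mu]_(t in time T) f^\+ t < +oo)%E.
  by rewrite ltey_eq (integrable_fin_num (measurable_time T) fp).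
apply: le_lt_trans fp_lty; rewrite -[leRHS]sube0 leeB//.
by apply: integral_ge0 => t _; exact: funeneg_ge0.
Qed.

Lemma conv_integral_integrable (R : realType) (T : \bar R)
    (mu : {measure set (\bar R) -> \bar R}) (f : \bar R -> \bar R) :
  measurable_fun (time T) f ->
  (-oo < conv_integral T mu f < +oo)%E -> mu.-integrable (time T) f.
Proof.
move=> mf /andP[+ /conv_integral_lty fp].
have mD := measurable_time T.
rewrite conv_integralE// integralE => f_gtNy.
have fn : mu.-integrable (time T) f^\-%E.
  apply/integrableP; split; first exact: measurable_funeneg.
  rewrite (eq_integral f^\-%E) => [|t _]; last by rewrite gee0_abs// funeneg_ge0.
  rewrite ltey; apply/eqP => fnE; move: f_gtNy.
  by rewrite fnE -(fineK (integrable_fin_num mD fp)).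
apply: eq_integrable (integrableB mD fp fn) => // t _.
by rewrite {3}(funeposneg f).
Qed.

Lemma le_conv_integral (R : realType) (T : \bar R)
    (mu : {measure set (\bar R) -> \bar R}) (f g : \bar R -> \bar R) :
  measurable_fun (time T) f -> measurable_fun (time T) g ->
  (forall t, time T t -> (f t <= g t)%E) ->
  (conv_integral T mu f <= conv_integral T mu g)%E.
Proof.
move=> mf mg fg; have mD := measurable_time T.
have [->|gy] := eqVneq (conv_integral T mu g) +oo%E; first exact: leey.
have gp : mu.-integrable (time T) g^\+%E by apply/conv_integral_lty; rewrite ltey.
have fpg t : time T t -> (f^\+ t <= g^\+ t)%E.
  by move=> Dt; rewrite !funeposE ge_max !le_max fg// lexx orbT.
have fng t : time T t -> (g^\- t <= f^\- t)%E.
  by move=> Dt; rewrite !funenegE ge_max !le_max leeN2 fg// lexx orbT.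
have fp : mu.-integrable (time T) f^\+%E.
  apply: le_integrable gp => //; first exact: measurable_funepos.
  by move=> t Dt; rewrite !gee0_abs ?funepos_ge0// fpg.
rewrite !conv_integralE// integralE [leRHS]integralE leeB//.
  by apply: ge0_le_integral => //; [exact: measurable_funepos|exact: measurable_funepos].
by apply: ge0_le_integral => //; [exact: measurable_funeneg|exact: measurable_funeneg].
Qed.

(** * The interchange of infimum and integral *)

(** Switching from [z] to [y] on the Borel set where [y] gives the smaller
    value would give the minimum.  If this set is replaced by a switching set,
    the error is supported by their symmetric difference, where it is at most
    the sum of the absolute values. *)
Lemma switching_l1_min (R : realType) (d : nat) (T : \bar R)
    (mu : {measure set (\bar R) -> \bar R}) (phi : \bar R -> 'rV[R]_d -> R)
    (A : set (\bar R -> 'rV[R]_d)) (y z : \bar R -> 'rV[R]_d) :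
  (forall V w w', cadlag_switching d T V -> A w -> A w' -> A (patch w' V w)) ->
  (forall w, A w -> mu.-integrable (time T) (fun t => (phi t (w t))%:E)) ->
  A y -> A z ->
  l1_closure mu (time T) [set (fun t => phi t (w t)) | w in A]
    ((fun t => phi t (y t)) \min (fun t => phi t (z t))).
Proof.
move=> Asw iA Ay Az; have mD := measurable_time T.
set f := fun t => phi t (y t); set g := fun t => phi t (z t).
have intf : mu.-integrable (time T) (EFin \o f) := iA _ Ay.
have intg : mu.-integrable (time T) (EFin \o g) := iA _ Az.
split; first exact: integrable_min.
move=> e e0.
pose b t := (`|f t| + `|g t|)%:E.
have ib : mu.-integrable (time T) b.
  have := integrableD mD (integrable_norm intf) (integrable_norm intg).
  exact: eq_integrable.
pose E := time T `&` (fun t => f t < g t) @^-1` [set true].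
have mE : measurable E.
  apply: (measurable_fun_ltr (measurable_integrable_EFin intf)
    (measurable_integrable_EFin intg)) => //.
have b0 t : time T t -> (0 <= b t)%E by move=> _; rewrite lee_fin addr_ge0.
have [V swV bV] := switching_approximation d ib b0 mE e0.
exists (fun t => phi t (patch z V y t)); first by exists (patch z V y) => //; exact: Asw.
apply: le_lt_trans bV; rewrite integral_mkcondr.
have iw := iA _ (Asw _ _ _ swV Ay Az).
have mV : measurable V := swV.1.
apply: ge0_le_integral => //.
- apply/measurable_EFinP; apply: measurableT_comp => //; apply: measurable_funB.
    exact: (measurable_integrable_EFin iw).
  exact: measurable_integrable_EFin (integrable_min mD intf intg).
- apply/measurable_restrict => //; first by apply: measurableU; exact: measurableD.
  by apply: measurable_funS (measurable_int _ ib) => //; exact: subIsetl.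
- move=> t Dt; rewrite [leRHS]patchE.
  have -> : phi t (patch z V y t) = if t \in V then f t else g t.
    by rewrite /patch; case: (t \in V).
  case: (boolP (t \in E `+` V)) => [_|/negP tEV].
    have fg0 : 0 <= `|f t| + `|g t| by rewrite addr_ge0.
    rewrite /b lee_fin /=.
    case: (t \in V); case: (leP (f t) (g t)) => _; rewrite ?subrr ?normr0//.
      exact: ler_normB.
    by rewrite distrC; exact: ler_normB.
  have {}tEV : (t \in V) = (f t < g t).
    apply/idP/idP => [/set_mem tV|fg]; apply: contrapT => nt; apply: tEV; apply: mem_set.
      by right; split => // -[_ /= fg]; exact: nt.
    by left; split => // tV; apply: nt; exact: mem_set.
  by rewrite tEV lee_fin /=; case: (ltP (f t) (g t)) => _; rewrite subrr normr0.
Qed.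

Lemma dom_integral_functional_switching (R : realType) (d : nat) (T : \bar R)
    (mu : {measure set (\bar R) -> \bar R})
    (h : \bar R -> 'rV[R]_d -> \bar R) (V : set (\bar R))
    (y z : \bar R -> 'rV[R]_d) :
  convex_normal_integrand T h -> cadlag_switching d T V ->
  dom_integral_functional T mu h y -> dom_integral_functional T mu h z ->
  dom_integral_functional T mu h (patch z V y).
Proof.
move=> h_normal swV [cy /conv_integral_lty hy] [cz /conv_integral_lty hz].
have cw := swV.2 _ _ cy cz; split => //; apply/conv_integral_lty.
have mD := measurable_time T.
apply: le_integrable (integrableD mD hy hz) => //.
  by apply: measurable_funepos; exact: measurable_cadlag_integrand.
move=> t _; rewrite !gee0_abs ?adde_ge0 ?funepos_ge0// !funeposE /patch.
by case: (t \in V); [rewrite leeDl|rewrite leeDr]; rewrite ?le_max ?lexx ?orbT.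
Qed.

Lemma cadlag_selections_switching (R : realType) (d : nat) (T : \bar R)
    (S : \bar R -> set 'rV[R]_d) (V : set (\bar R)) (y z : \bar R -> 'rV[R]_d) :
  cadlag_switching d T V -> cadlag_selections T S y -> cadlag_selections T S z ->
  cadlag_selections T S (patch z V y).
Proof.
move=> swV [cy Sy] [cz Sz]; split; first exact: swV.2.
by move=> t Dt; rewrite /patch; case: (t \in V); [exact: Sy|exact: Sz].
Qed.

(** A point of [S t] is first approximated by a value of a selection, then that
    selection by a member of [A] in the supremum norm, and finally the value of
    this member at [t] by a value of some [z] in [B]. *)
Lemma pointwise_dense_selections (R : realType) (d : nat) (T : \bar R)
    (S : \bar R -> set 'rV[R]_d) (A B : set (\bar R -> 'rV[R]_d)) (t : \bar R) :
  cadlag_selections T S = cadlag_closure T A ->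
  S t = closure [set y t | y in cadlag_selections T S] ->
  (forall y (e : R), A y -> 0 < e -> exists2 z, B z & `|y t - z t| < e) ->
  time T t -> S t `<=` closure [set z t | z in B].
Proof.
move=> DS_cl St Bdense Dt.
rewrite St [X in _ `<=` X]((closure_id _).1 (@closed_closure _ _)).
apply: closure_subset => _ [y + <-]; rewrite DS_cl => -[cy clAy].
move=> O /nbhs_ballP[e /= e0 eO].
have e20 : 0 < e / 2 by rewrite divr_gt0.
have [w Aw yw] := clAy _ e20.
have [z Bz wz] := Bdense w (e / 2) Aw e20.
exists (z t); split; first by exists z.
apply: eO; rewrite mx_norm_ball /ball_ /=.
rewrite -(subrKA (w t)) (splitr e) (le_lt_trans (ler_normD _ _))// ltrD//.
rewrite -lte_fin; apply: le_lt_trans yw; apply: ereal_sup_ubound.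
by exists t.
Qed.

Theorem theorem2 (R : realType) (d : nat) (T : \bar R) (T_gt0 : (0 < T)%E)
    (mu : {measure set (\bar R) -> \bar R}) (mu_radon : radon_measure T mu)
    (h : \bar R -> 'rV[R]_d -> \bar R)
    (h_normal : convex_normal_integrand T h)
    (S_selections : forall t, time T t ->
       cl_dom h t =
       closure [set y t | y in cadlag_selections T (cl_dom h)])
    (DS_closure :
       cadlag_selections T (cl_dom h) =
       cadlag_closure T (dom_integral_functional T mu h `&`
                         cadlag_selections T (cl_dom h))) :
  (ereal_inf [set integral_functional T mu h y
             | y in cadlag_selections T (cl_dom h)] < +oo)%E ->
  ereal_inf [set integral_functional T mu h y
            | y in cadlag_selections T (cl_dom h)] =
  conv_integral T mu (fun t => ereal_inf [set h t x | x in [set: 'rV[R]_d]]).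
Proof.
set DS := cadlag_selections T (cl_dom h) in S_selections DS_closure *.
set phi := fun t => ereal_inf [set h t x | x in [set: 'rV[R]_d]].
set Ih := integral_functional T mu h.
move=> inf_lty; have mD := measurable_time T.
have mh y : cadlag T y -> measurable_fun (time T) (fun t => h t (y t)).
  exact: measurable_cadlag_integrand.
have mphi : measurable_fun (time T) phi by exact: measurable_infimum_integrand.
apply/eqP; rewrite eq_le; apply/andP; split; last first.
  apply: le_ereal_inf_tmp => _ [y [cy _] <-].
  apply: le_conv_integral => //; first exact: mh.
  by move=> t _; apply: ereal_inf_lbound; exists (y t).
have [->|inf_Ny] := eqVneq (ereal_inf [set Ih y | y in DS]) -oo%E; first exact: leNye.
have inf_fin : ereal_inf [set Ih y | y in DS] \is a fin_num.
  by rewrite fin_numE inf_Ny -ltey.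
rewrite -(fineK inf_fin); set L := fine _.
have LI y : DS y -> (L%:E <= Ih y)%E.
  by move=> DSy; rewrite fineK//; apply: ereal_inf_lbound; exists y.
pose A := dom_integral_functional T mu h `&` DS.
have Asw V w w' : cadlag_switching d T V -> A w -> A w' -> A (patch w' V w).
  move=> swV [Iw DSw] [Iw' DSw']; split.
    exact: dom_integral_functional_switching.
  exact: cadlag_selections_switching.
have ih w : A w -> mu.-integrable (time T) (fun t => h t (w t)).
  move=> [[cw Iw] DSw]; apply: conv_integral_integrable; first exact: mh.
  by rewrite Iw andbT (lt_le_trans _ (LI _ DSw))// ltNyr.
(* Real-valued versions: [h t (w t)] may be infinite on a null set. *)
pose psi t x := fine (h t x).
have ipsi w : A w -> mu.-integrable (time T) (fun t => (psi t (w t))%:E).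
  move=> Aw; apply: le_integrable (ih _ Aw) => //.
    apply/measurable_EFinP; apply: measurableT_comp; first exact: fine_measurable.
    exact: measurable_int (ih _ Aw).
  by move=> t _; rewrite /psi; case: (h t (w t)) => [r| |] /=; rewrite ?lexx ?leey.
have Lpsi w : A w -> (L%:E <= \int[mu]_(t in time T) (psi t (w t))%:E)%E.
  move=> Aw; have [[cw Iw] DSw] := Aw; have := LI _ DSw.
  rewrite /Ih /integral_functional conv_integralE; last exact/conv_integral_lty.
  rewrite (ae_eq_integral (fun t => (psi t (w t))%:E))//; first exact: mh.
    exact: measurable_int (ipsi _ Aw).
  by apply: filterS (integrable_ae mD (ih _ Aw)) => t fin Dt; rewrite fineK// fin.
have [B [cB BA Bdense]] : exists B, [/\ countable B, B `<=` A &
    forall t y (e : R), time T t -> A y -> 0 < e ->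
      exists2 z, B z & `|y t - z t| < e].
  by apply: countable_pointwise_dense => y [[]].
have [y0 Ay0] : A !=set0.
  have [_ [y DSy <-] Iy] := ereal_inf_lt inf_lty.
  by exists y; split => //; split => //; case: DSy.
have [|Y YB] := countable_range cB.
  (* As [0 < T], time [0] exists and [Y] can be indexed by [nat]. *)
  have [|z Bz _] := Bdense 0%E y0 1 _ Ay0 ltr01; last by exists z.
  by rewrite /time/= lexx ltW.
have AY n : A (Y n) by apply: BA; rewrite -YB; exists n.
pose m n t := running_min (fun k => psi t (Y k t)) n.
pose F := [set (fun t => psi t (w t)) | w in A].
have intF f : F f -> mu.-integrable (time T) (EFin \o f).
  by move=> [w Aw <-]; exact: ipsi.
have m_clF n : l1_closure mu (time T) F (m n).
  have psi_clF k : l1_closure mu (time T) F (fun t => psi t (Y k t)).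
    split; first exact: ipsi.
    move=> e e0; exists (fun t => psi t (Y k t)); first by exists (Y k).
    by rewrite integral0_eq// => t _; rewrite subrr normr0.
  elim: n => [|n IH]; first exact: psi_clF.
  apply: (l1_closure_min mD intF _ IH (psi_clF n.+1)).
  by move=> _ _ [y Ay <-] [z Az <-]; exact: switching_l1_min.
have Lm n : (L%:E <= \int[mu]_(t in time T) (m n t)%:E)%E.
  apply: l1_closure_integral_ge (m_clF n) => // f [w Aw <-]; exact: Lpsi.
have Lphi : (L%:E <= \int[mu]_(t in time T) phi t)%E.
  apply: (integral_inf_ge (m := m)) => //.
  - by move=> t _; exact: running_min_nonincreasing.
  - by move=> n; have [] := m_clF n.
  have : {ae mu, forall t, forall n, time T t -> h t (Y n t) \is a fin_num}.
    by apply/ae_foralln => n; exact: (integrable_ae mD (ih _ (AY n))).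
  apply: filterS => t finY Dt.
  rewrite running_min_inf /phi.
  rewrite -(@convex_inf_dense _ _ (h t) [set z t | z in B]).
  - rewrite -YB image_comp; congr (ereal_inf _); rewrite image_comp.
    by apply: eq_imagel => n _ /=; rewrite /psi fineK// finY.
  - exact: (h_normal.1 t Dt).2.
  - move=> _ [z + <-]; rewrite -YB => -[n _ <-].
    by rewrite /edom/= ltey_eq finY.
  - apply: subset_trans (@subset_closure _ _) _.
    apply: (pointwise_dense_selections DS_closure (S_selections t Dt)) => //.
    by move=> y e Ay e0; exact: Bdense.
have [->|phi_y] := eqVneq (conv_integral T mu phi) +oo%E; first exact: leey.
by rewrite conv_integralE//; apply/conv_integral_lty; rewrite ltey.
Qed.
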